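(* Let $n$ be a positive integer. For any $K\in\mathcal{K}^n$ and any integer $m\ge 4$, we have $\breve{\breve w}_m(K)=\infty$.
   Context: $\mathcal{K}^n$ denotes the class of $n$-dimensional convex bodies, i.e. compact convex subsets of $\mathbb{R}^n$ with nonempty interior. For $K\in\mathcal{K}^n$, $C(K)$ is the space of continuous real-valued functions on $K$ with norm $\|f\|_K=\max_{x\in K}|f(x)|$, and $\breve C(K)$ is the set of those $f\in C(K)$ that are convex on $K$, i.e. satisfy $f(x)+f(y)\ge 2f((x+y)/2)$ for all $x,y\in K$. $\mathcal{P}_{m,n}$ is the space of real algebraic polynomials of total degree $\le m$ in $n$ variables. For $f\in\breve C(K)$, the error of approximation by convex polynomials is \[ \breve E_m(f;K)=\inf_{P\in\mathcal{P}_{m,n}\cap\breve C(K)}\|f-P\|_K \] (the infimum is over polynomials in $\mathcal{P}_{m,n}$ whose restriction to $K$ is convex). The $m$-th modulus of smoothness of $f\in C(K)$ is \[ \omega_m(f;K)=\max_{x,x+h,\dots,x+mh\in K}|\Delta_h^m(f;x)|,\qquad \Delta_h^m(f;x)=\sum_{j=0}^m(-1)^j\binom mj f(x+jh), \] the maximum being over all $x,h\in\mathbb{R}^n$ with $x,x+h,\dots,x+mh\in K$. The convexity preserving Whitney constant is \[ \breve{\breve w}_m(K)=\sup\{\breve E_{m-1}(f;K): f\in\breve C(K),\ \omega_m(f;K)\le 1\}. \] *)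

(* Defs.v *)
From HB Require Import structures.
From mathcomp Require Import all_boot all_order all_algebra.
From mathcomp Require Import all_classical all_reals all_analysis.
(* The notations of mpoly are left out: they clash with those of analysis. *)
From mathcomp Require Import (canonicals, coercions) mpoly.

Set Implicit Arguments.
Unset Strict Implicit.
Unset Printing Implicit Defensive.

Import Order.TTheory GRing.Theory Num.Theory.
Import numFieldNormedType.Exports.

Local Open Scope classical_set_scope.
Local Open Scope ring_scope.

(* R^n is 'rV[R]_n; its library norm is the max norm, which induces the usual
   topology. *)

Definition convex_body (R : realType) (n : nat) (K : set 'rV[R]_n) : Prop :=
  [/\ compact K, convex_set K & interior K !=set0].

(* A function on K is represented by a total function on R^n, of which only the
   values on K matter. *)

Definition midpoint_convex (R : realType) (n : nat) (K : set 'rV[R]_n)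
    (f : 'rV[R]_n -> R) : Prop :=
  forall x y, K x -> K y -> f x + f y >= 2 * f (2^-1 *: (x + y)).

Definition convex_continuous (R : realType) (n : nat) (K : set 'rV[R]_n) :
    set ('rV[R]_n -> R) :=
  [set f | {within K, continuous f} /\ midpoint_convex K f].

(* The maxima in the norm and in the modulus of smoothness are written as
   suprema in \bar R; they are attained for f continuous on a nonempty compact
   set K. *)

Definition supnorm (R : realType) (n : nat) (K : set 'rV[R]_n)
    (f : 'rV[R]_n -> R) : \bar R :=
  ereal_sup [set `|f x|%:E | x in K].

Definition findiff (R : realType) (n m : nat) (h : 'rV[R]_n)
    (f : 'rV[R]_n -> R) (x : 'rV[R]_n) : R :=
  \sum_(j < m.+1) (-1) ^+ j * 'C(m, j)%:R * f (x + h *+ j).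

Definition modulus (R : realType) (n m : nat) (K : set 'rV[R]_n)
    (f : 'rV[R]_n -> R) : \bar R :=
  ereal_sup [set `|findiff m xh.2 f xh.1|%:E | xh in
    [set xh : 'rV[R]_n * 'rV[R]_n |
      forall j : nat, (j <= m)%N -> K (xh.1 + xh.2 *+ j)]].

Definition polyfun (R : realType) (n : nat) (p : mpoly.mpoly n R)
    (x : 'rV[R]_n) : R :=
  mpoly.meval (fun i => x ord0 i) p.

(* msize is the total degree plus one, and msize 0 = 0. *)
Definition poly_degree_le (R : realType) (m n : nat) : set (mpoly.mpoly n R) :=
  [set p | (mpoly.msize p <= m.+1)%N].

Definition convex_approx_error (R : realType) (n m : nat) (K : set 'rV[R]_n)
    (f : 'rV[R]_n -> R) : \bar R :=
  ereal_inf [set supnorm K (fun x => f x - polyfun p x) | p in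
    [set p : mpoly.mpoly n R |
      poly_degree_le m p /\ convex_continuous K (polyfun p)]].

(* Meant for m >= 1, because of the truncated m.-1. *)
Definition convex_whitney (R : realType) (n m : nat) (K : set 'rV[R]_n) :
    \bar R :=
  ereal_sup [set convex_approx_error m.-1 K f | f in
    [set f : 'rV[R]_n -> R |
      convex_continuous K f /\ (modulus m K f <= 1%:E)%E]].

(* Main.v *)
Require Import Defs.
From mathcomp Require Import all_boot all_order all_algebra.
From mathcomp Require Import all_classical all_reals all_analysis.
From mathcomp Require Import (canonicals, coercions) mpoly.
From mathcomp Require Import ring lra zify.

(** The reason is that polynomials are too rigid at the boundary of K. Take the
    cubic (N t - 1)^3, where t is an affine function that is nonnegative on K
    and vanishes somewhere on it. It is concave only on the thin layer
    t <= 1/N, and replacing it there by 0 gives the convex function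
    max(0, N t - 1)^3, which is within 1 of the cubic on K. For m >= 4 the m-th
    differences of the cubic vanish, so those of the convex function are bounded
    by 2^m, uniformly in N (modulus_truncated_cube_of_coord_le1).

    A polynomial P of degree less than m that stays within a fixed distance of
    this function also stays within a fixed distance of the cubic. On a segment
    that starts where t = 0, the difference between P and the cubic is then a
    bounded polynomial of bounded degree, so its second derivative at the
    starting point is bounded (poly_second_difference_bound), while that of the
    cubic is -6 N^2. Hence P is not convex once N is large
    (poly_near_truncated_cube_not_convex), and no uniform bound on the error of
    approximation by convex polynomials is possible. In dimension n the function
    t is a coordinate of the space, suitably normalized, and the polynomials are
    restricted to a segment between a minimizer of that coordinate over K and a
    point of K where it is larger. *)

Import Order.TTheory GRing.Theory Num.Theory.
Import numFieldNormedType.Exports.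
Local Open Scope ring_scope.
Local Open Scope classical_set_scope.

Set Implicit Arguments.
Unset Strict Implicit.
Unset Printing Implicit Defensive.

(** * The truncated cube *)

(** The truncated cube u |-> max(0, u)^3 is convex on the whole line, while the
    cube itself is strictly concave for u < 0; the two nevertheless differ by
    at most 1 as long as only the concave piece [-1, 0] is involved. *)
Lemma truncated_cube_near (R : realDomainType) (u : R) :
  -1 <= u -> `|Num.max 0 u ^+ 3 - u ^+ 3| <= 1.
Proof.
move=> u1; case: (leP 0 u) => u0; first by rewrite subrr normr0.
rewrite expr0n sub0r ler_norml; apply/andP; split; nra.
Qed.

(** The positive part is subadditive, and the cube is convex on [0, +oo[. *)
Lemma truncated_cube_midpoint_convex (R : realFieldType) (u v : R) :
  2 * Num.max 0 (2^-1 * (u + v)) ^+ 3 <= Num.max 0 u ^+ 3 + Num.max 0 v ^+ 3.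
Proof.
set a := Num.max 0 u; set b := Num.max 0 v.
have a0 : 0 <= a by rewrite le_max lexx.
have b0 : 0 <= b by rewrite le_max lexx.
apply: (@le_trans _ _ (2 * (2^-1 * (a + b)) ^+ 3)).
  rewrite ler_wpM2l // lerXn2r ?nnegrE ?le_max ?lexx //.
    by rewrite mulr_ge0 ?addr_ge0 // invr_ge0.
  rewrite ge_max mulr_ge0 ?addr_ge0 ?invr_ge0 //=.
  by rewrite ler_wpM2l ?invr_ge0 // lerD // le_max lexx orbT.
rewrite -subr_ge0.
have -> : a ^+ 3 + b ^+ 3 - 2 * (2^-1 * (a + b)) ^+ 3 =
  (3 / 4) * ((a + b) * (a - b) ^+ 2) by field.
by rewrite mulr_ge0 // mulr_ge0 ?addr_ge0 ?sqr_ge0.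
Qed.

(** * Finite differences of cubics *)

(** The sign is the one produced by the alternating binomial sums; naming the
    operation lets the next lemma be iterated by rewriting. *)
Definition neg_forward_diff (R : pzRingType) (g : nat -> R) (j : nat) : R :=
  g j - g j.+1.

(** Pascal's rule: an m.+1-th difference is an m-th difference of first
    differences. *)
Lemma alternating_binomial_sum_succ (R : pzRingType) (m : nat) (g : nat -> R) :
  \sum_(j < m.+2) (-1) ^+ j * 'C(m.+1, j)%:R * g j =
  \sum_(j < m.+1) (-1) ^+ j * 'C(m, j)%:R * neg_forward_diff g j.
Proof.
pose F (j : nat) := (-1) ^+ j * 'C(m, j)%:R * g j.
(* The vanishing term 'C(m, m.+1) gives both sums the same range. *)
have FE : \sum_(j < m.+1) F j = \sum_(j < m.+2) F j.
  by rewrite [RHS]big_ord_recr /= {3}/F bin_small // mulr0 mul0r addr0.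
under [RHS]eq_bigr do rewrite /neg_forward_diff mulrBr -/(F _).
rewrite sumrB FE [LHS]big_ord_recl [in RHS]big_ord_recl /F /= !bin0 -addrA.
congr (_ + _); rewrite -sumrB; apply: eq_bigr => j _; rewrite /bump /= add1n.
by rewrite binS natrD exprS mulrDr mulrDl !mulN1r !mulNr.
Qed.

(** Differences of order at least 4 annihilate cubics: peel off four first
    differences, after which nothing is left of the cubic. *)
Lemma alternating_binomial_sum_cube (R : comPzRingType) (m : nat) (a b : R) : (4 <= m)%N ->
  \sum_(j < m.+1) (-1) ^+ j * 'C(m, j)%:R * (a + b *+ j) ^+ 3 = 0.
Proof.
case: m => [|[|[|[|m]]]] // _.
rewrite (alternating_binomial_sum_succ _ (fun j => (a + b *+ j) ^+ 3)).
rewrite !alternating_binomial_sum_succ.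
apply: big1 => j _; rewrite (_ : neg_forward_diff _ j = 0) ?mulr0 //.
rewrite /neg_forward_diff !mulrS; move: (b *+ j) => t; ring.
Qed.

(** * Bounded polynomials on the unit interval *)

(** Equivalence of norms on the polynomials of bounded degree, in the form of a
    bound on the coefficients by the maximum over [0, 1]. The induction removes
    the top coefficient by the dilation trick: 2^d p(t/2) - p(t) has no term of
    degree d, is bounded by (2^d + 1) B, and its other coefficients are those
    of p multiplied by 2^(d-i) - 1 >= 1. The top coefficient is then recovered
    from p(1). *)
Lemma poly_coef_bound (R : realFieldType) (d : nat) :
  exists2 C : R, 0 <= C & forall (p : {poly R}) (B : R), (size p <= d)%N ->
    (forall t : R, 0 <= t <= 1 -> `|p.[t]| <= B) -> forall k, `|p`_k| <= C * B.
Proof.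
elim: d => [|d [C C0 IH]].
  exists 0 => // p B; rewrite leqn0 size_poly_eq0 => /eqP -> _ k.
  by rewrite coef0 normr0 mul0r.
pose D := C * (2 ^+ d + 1).
have D0 : 0 <= D by rewrite mulr_ge0 // addr_ge0 // exprn_ge0.
exists (1 + D *+ d.+1) => [|p B sp pB k]; first by rewrite addr_ge0 // mulrn_wge0.
have B0 : 0 <= B by apply: le_trans (pB 0 _); rewrite ?lexx ?ler01.
have pE t : p.[t] = \sum_(i < d.+1) p`_i * t ^+ i := horner_coef_wide t sp.
pose q := \poly_(i < d) ((2 ^+ (d - i) - 1) * p`_i).
have qE t : q.[t] = 2 ^+ d * p.[t / 2] - p.[t].
  rewrite horner_poly !pE mulr_sumr -sumrB big_ord_recr /=.
  have -> : 2 ^+ d * (p`_d * (t / 2) ^+ d) = p`_d * t ^+ d.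
    by rewrite expr_div_n; field; rewrite expf_neq0 // pnatr_eq0.
  rewrite subrr addr0; apply: eq_bigr => i _.
  rewrite expr_div_n (_ : 2 ^+ d = 2 ^+ (d - i) * 2 ^+ i); last first.
    by rewrite -exprD subnK // ltnW.
  by field; rewrite expf_neq0 // pnatr_eq0.
have low i : (i < d)%N -> `|p`_i| <= D * B.
  move=> id; apply: (@le_trans _ _ `|q`_i|).
    rewrite coef_poly id normrM ler_peMl // ler_normr; apply/orP; left.
    rewrite lerBrDr -(@prednK (d - i)) ?subn_gt0 // exprS.
    by rewrite ler_pMr // exprn_ege1 // ler1n.
  rewrite -mulrA; apply: IH => [|t t01]; first exact: size_poly.
  rewrite qE (le_trans (ler_normB _ _)) // mulrDl mul1r lerD ?pB //.
  rewrite normrM ger0_norm ?exprn_ge0 // ler_wpM2l ?exprn_ge0 // pB //; lra.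
have [kd|] := ltnP k d.
  apply: le_trans (low _ kd) _; rewrite ler_wpM2r // mulrSr.
  by rewrite addrA lerDr addr_ge0 // mulrn_wge0.
rewrite leq_eqVlt => /orP[/eqP <-|dk]; last first.
  rewrite nth_default ?(leq_trans sp) // normr0.
  by rewrite mulr_ge0 // addr_ge0 // mulrn_wge0.
have -> : p`_d = p.[1] - \sum_(i < d) p`_i.
  rewrite pE big_ord_recr /= expr1n mulr1.
  by under eq_bigr do rewrite expr1n mulr1; rewrite addrC addrK.
rewrite (le_trans (ler_normB _ _)) // mulrDl mul1r lerD ?pB ?lexx ?ler01 //.
rewrite (le_trans (ler_norm_sum _ _ _)) // (@le_trans _ _ (\sum_(i < d) D * B)) //.
  by apply: ler_sum => i _; exact: low.
by rewrite sumr_const card_ord -mulrnAl ler_wpM2r // ler_wpMn2l.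
Qed.

(** A Markov-type inequality at the end point 0, stated with a second difference
    instead of the second derivative: the terms of degree 0 and 1 cancel, and
    every remaining monomial contributes a factor s^2. *)
Lemma poly_second_difference_bound (R : realFieldType) (d : nat) :
  exists2 C : R, 0 <= C & forall (p : {poly R}) (B s : R), (size p <= d)%N ->
    (forall t : R, 0 <= t <= 1 -> `|p.[t]| <= B) -> 0 <= s <= 1 ->
    `|p.[0] + p.[2 * s] - 2 * p.[s]| <= C * B * s ^+ 2.
Proof.
have [C C0 HC] := @poly_coef_bound R d.
exists (\sum_(i < d) C * 2 ^+ i).
  by apply: sumr_ge0 => i _; rewrite mulr_ge0 // exprn_ge0.
move=> p B s sp pB /andP[s0 s1].
have B0 : 0 <= B by apply: le_trans (pB 0 _); rewrite ?lexx ?ler01.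
rewrite !(horner_coef_wide _ sp) mulr_sumr -big_split -sumrB /=.
rewrite (le_trans (ler_norm_sum _ _ _)) // !mulr_suml ler_sum // => i _.
rewrite (_ : _ - _ = p`_i * (0 ^+ i + (2 * s) ^+ i - 2 * s ^+ i)); last by ring.
(* This is the second difference of the i-th monomial. *)
have diffB : `|0 ^+ i + (2 * s) ^+ i - 2 * s ^+ i| <= 2 ^+ i * s ^+ 2.
  have R0 k : 0 <= 2 ^+ k * s ^+ 2 by rewrite mulr_ge0 // exprn_ge0.
  case: (val i) => [|[|k]].
  - by rewrite (_ : _ - _ = 0) ?normr0 //; ring.
  - by rewrite (_ : _ - _ = 0) ?normr0 //; ring.
  rewrite expr0n add0r exprMn -mulrBl normrM ler_pM //.
    have ge2 : 2 <= 2 ^+ k.+2 :> R.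
      by rewrite exprS ler_pMr // exprn_ege1 // ler1n.
    rewrite ger0_norm; lra.
  by rewrite ger0_norm ?exprn_ge0 // ler_wiXn2l.
rewrite normrM (_ : _ * B * _ = (C * B) * (2 ^+ i * s ^+ 2)); last by ring.
by rewrite ler_pM // HC.
Qed.

(** This is the one-dimensional obstruction. A polynomial q within A of the
    truncated cube of N t - 1 is within A + 1 of the cubic (N t - 1)^3, so its
    second difference at 0 with step s = 1/(2N) differs from that of the cubic
    by O((A + 1) / N^2). The second difference of the cubic is -3/4 whatever N
    is, because the cubic goes through -1, -1/8, 0 at the points 0, s, 2s. For
    N large the second difference of q is therefore negative. *)
Lemma poly_near_truncated_cube_not_convex (R : realFieldType) (d : nat) (A : R) :
  (4 <= d)%N -> 0 <= A ->
  exists2 N : R, 1 <= N & forall q : {poly R}, (size q <= d)%N ->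
    (forall t : R, 0 <= t <= 1 -> `|Num.max 0 (N * t - 1) ^+ 3 - q.[t]| <= A) ->
    q.[0] + q.[N^-1] < 2 * q.[N^-1 / 2].
Proof.
move=> d4 A0; have [C C0 HC] := @poly_second_difference_bound R d.
have CA0 : 0 <= C * (A + 1) by rewrite mulr_ge0 // addr_ge0.
(* The error term C (A + 1) / (4 N^2) has to be below 3/4. *)
exists (1 + C * (A + 1)) => [|q sq]; first by rewrite lerDl.
set N := 1 + _ => qA.
have N1 : 1 <= N by rewrite lerDl.
have N0 : N != 0 by rewrite gt_eqF // (lt_le_trans ltr01).
have V0 : 0 <= N^-1 by rewrite invr_ge0; lra.
have V1 : N^-1 <= 1 by rewrite invf_le1 //; lra.
pose c := N%:P * 'X - 1; pose r := q - c ^+ 3.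
have cE t : (c ^+ 3).[t] = (N * t - 1) ^+ 3.
  by rewrite horner_exp !hornerE.
have sc : (size (c ^+ 3)%R <= d)%N.
  apply: leq_trans (size_poly_exp_leq _ _) _.
  have : (size c <= 2)%N.
    rewrite /c -polyC1 -polyCN.
    by rewrite size_MXaddC; case: ifP => // _; rewrite ltnS size_polyC; case: eqP.
  lia.
have sr : (size r <= d)%N.
  by rewrite (leq_trans (size_polyD _ _)) // geq_max sq size_polyN.
have rB t : 0 <= t <= 1 -> `|r.[t]| <= A + 1.
  move=> /[dup] /andP[t0 _] /qA qAt.
  rewrite /r hornerD hornerN cE.
  have := @truncated_cube_near _ (N * t - 1).
  have Nt0 : 0 <= N * t by rewrite mulr_ge0 //; lra.
  move=> /(_ ltac:(lra)); move: qAt; rewrite !ler_norml; lra.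
have := HC r _ (N^-1 / 2) sr rB; rewrite /r !(hornerD, hornerN) !cE.
have -> : 2 * (N^-1 / 2) = N^-1 by field.
rewrite mulr0 mulfV // (_ : N * (N^-1 / 2) = 1 / 2); last by field.
have -> : C * (A + 1) * (N^-1 / 2) ^+ 2 = (1 - N^-1) * N^-1 / 4.
  by rewrite (_ : C * (A + 1) = N - 1); [field|rewrite /N; ring].
move=> /(_ ltac:(lra)); rewrite ler_norml => /andP[_ +].
nra.
Qed.

(** * Segments in a convex body *)

(** The degree bound survives the substitution of affine functions of t for the
    variables, since each of them has degree at most 1. *)
Lemma polyfun_line (R : realType) (n d : nat) (p : mpoly.mpoly n R)
    (x v : 'rV[R]_n) : (mpoly.msize p <= d)%N ->
  exists2 q : {poly R}, (size q <= d)%N &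
    forall t, q.[t] = polyfun p (x + t *: v).
Proof.
move=> pd; pose h i : {poly R} := (v ord0 i)%:P * 'X + (x ord0 i)%:P.
have sh i : (size (h i) <= 2)%N.
  by rewrite size_MXaddC; case: ifP => // _; rewrite ltnS size_polyC leq_b1.
exists (\sum_(a <- mpoly.msupp p)
          (mpoly.mcoeff a p) *: \prod_i h i ^+ a i) => [|t].
  rewrite (leq_trans (size_sum _ _ _)) //.
  rewrite big_seq; elim/big_ind: _ => // [k l|a ap]; first by rewrite geq_max => -> ->.
  rewrite (leq_trans (size_scale_leq _ _)) // (leq_trans _ pd) //.
  apply: leq_trans (mpoly.msize_mdeg_lt ap); rewrite mpoly.mdegE.
  rewrite (leq_trans (size_poly_prod_leq _ _)) // leq_subLR -sum1_card addnS ltnS -big_split.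
  apply: leq_sum => i _; apply: leq_trans (size_poly_exp_leq _ _) _.
  move: (sh i); case: (size _) => [|[|[|k]]] //= _; rewrite ?mul0n ?mul1n /=; lia.
rewrite /polyfun mpoly.mevalE horner_sum; apply: eq_bigr => a _.
rewrite hornerZ horner_prod; congr (_ * _); apply: eq_bigr => i _.
by rewrite horner_exp !hornerE !mxE addrC mulrC.
Qed.

Lemma convex_set_segment (R : realType) (n : nat) (K : set 'rV[R]_n)
    (x y : 'rV[R]_n) (t : R) : convex_set K -> K x -> K y -> 0 <= t <= 1 ->
  K (x + t *: (y - x)).
Proof.
move=> cK Kx Ky /andP[t0 t1].
have := cK y x (Itv01 t0 t1) (mem_set Ky) (mem_set Kx).
move=> /set_mem; congr K; apply/rowP => k; rewrite !mxE /unstable.onem /=; ring.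
Qed.

(** The minimizer of a coordinate will be the point where the convexity of an
    approximating polynomial breaks down; a coordinate is not constant on K
    because K has an interior point. *)
Lemma convex_body_coord_min (R : realType) (n : nat) (K : set 'rV[R]_n)
    (i : 'I_n) : convex_body K ->
  exists x y : 'rV[R]_n, [/\ K x, K y, x ord0 i < y ord0 i &
    forall z, K z -> x ord0 i <= z ord0 i].
Proof.
move=> [cK _ [z zK]].
have Kz : K z by exact: interior_subset zK.
have [||x /set_mem Kx xmin] := @EVT_min_rV R n (fun z => z ord0 i) K _ cK.
- by exists z.
- exact/continuous_subspaceT/coord_continuous.
have /nbhs_ballP[e /= e0 eK] := zK.
exists x, (z + const_mx (e / 2)); split=> //.
- apply: eK; split=> // k l; rewrite !mxE /ball /=.
  rewrite opprD addrA subrr sub0r normrN ger0_norm; lra.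
- by rewrite !mxE (le_lt_trans (xmin z (mem_set Kz))) // ltrDl divr_gt0.
- by move=> w Kw; apply: xmin; exact: mem_set.
Qed.

(** * The extremal functions *)

(** A ridge function: the truncated cube of an affine function of the coordinate
    i. The factor 2^-m normalizes its m-th modulus of smoothness. *)
Definition truncated_cube_of_coord (R : realType) (n m : nat) (i : 'I_n) (a c : R)
    (x : 'rV[R]_n) : R :=
  2 ^- m * Num.max 0 (c * (x ord0 i - a) - 1) ^+ 3.

Lemma truncated_cube_of_coord_convex_continuous (R : realType) (n m : nat) (i : 'I_n)
    (a c : R) (K : set 'rV[R]_n) :
  convex_continuous K (truncated_cube_of_coord m i a c).
Proof.
split=> [|x y _ _].
  apply: continuous_subspaceT => z.
  pose g (w : 'rV[R]_n) : R := c * (w ord0 i - a) - 1.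
  have cg : {for z, continuous g}.
    rewrite /g; apply: continuousB; last exact: cst_continuous.
    apply: continuousM; first exact: cst_continuous.
    by apply: continuousB; [exact: coord_continuous|exact: cst_continuous].
  have cg0 : {for z, continuous (fun w => Num.max 0 (g w))}.
    exact: (continuous_max (f := fun=> 0) (@cst_continuous _ _ _ z) cg).
  have cg3 : {for z, continuous (fun w => Num.max 0 (g w) ^+ 3)}.
    exact: (continuous_comp cg0 (@exprn_continuous R 3 _)).
  by apply: (continuousM (s := fun=> 2 ^- m) _ cg3); exact: cst_continuous.
rewrite /truncated_cube_of_coord mulrCA -mulrDr ler_wpM2l ?invr_ge0 ?exprn_ge0 //.
rewrite !mxE.
have -> : c * (2^-1 * (x ord0 i + y ord0 i) - a) - 1 =
  2^-1 * ((c * (x ord0 i - a) - 1) + (c * (y ord0 i - a) - 1)) by field.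
exact: truncated_cube_midpoint_convex.
Qed.

(** The m-th differences see only the deviation from the cubic, which is at most
    1 on K, and the absolute values of their coefficients add up to 2^m. The
    bound does not depend on the slope c. *)
Lemma modulus_truncated_cube_of_coord_le1 (R : realType) (n m : nat) (i : 'I_n)
    (a c : R) (K : set 'rV[R]_n) : (4 <= m)%N -> 0 <= c ->
  (forall z, K z -> a <= z ord0 i) ->
  (modulus m K (truncated_cube_of_coord m i a c) <= 1%:E)%E.
Proof.
move=> m4 c0 aK; apply: ge_ereal_sup => _ [[x h] /= xhK <-].
rewrite lee_fin /findiff.
(* In the direction h, the cubic is a cubic polynomial in the index j. *)
pose u j := c * ((x + h *+ j) ord0 i - a) - 1.
have cube0 : \sum_(j < m.+1) (-1) ^+ j * 'C(m, j)%:R * u j ^+ 3 = 0.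
  rewrite -[RHS](alternating_binomial_sum_cube (c * (x ord0 i - a) - 1) (c * h ord0 i) m4).
  apply: eq_bigr => j _; congr (_ * _ ^+ 3).
  by rewrite /u mxE mulmxnE -mulr_natr; ring.
rewrite (_ : \sum_(j < _) _ = 2 ^- m *
    \sum_(j < m.+1) (-1) ^+ j * 'C(m, j)%:R * (Num.max 0 (u j) ^+ 3 - u j ^+ 3)).
  rewrite normrM ger0_norm ?invr_ge0 ?exprn_ge0 //.
  rewrite mulrC ler_pdivrMr ?exprn_gt0 // mul1r.
  rewrite (_ : 2 ^+ m = \sum_(j < m.+1) 'C(m, j)%:R :> R).
    rewrite (le_trans (ler_norm_sum _ _ _)) // ler_sum // => j _.
    rewrite normrM normrMsign normr_nat ler_piMr // truncated_cube_near //.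
    rewrite lerBrDr addNr mulr_ge0 // subr_ge0 aK //.
    by apply: xhK; rewrite -ltnS.
  by rewrite -natrX (expnDn 1 1) natr_sum; apply: eq_bigr => j _; rewrite !exp1n !muln1.
under [in RHS]eq_bigr do rewrite mulrBr.
rewrite sumrB cube0 subr0 mulr_sumr; apply: eq_bigr => j _.
by rewrite /truncated_cube_of_coord mulrCA.
Qed.

Theorem theorem1p5 (R : realType) (n : nat) (hn : (0 < n)%N)
    (K : set 'rV[R]_n) (hK : convex_body K) (m : nat) (hm : (4 <= m)%N) :
  convex_whitney m K = +oo%E.
Proof.
have [x [y [Kx Ky xy xmin]]] := convex_body_coord_min (Ordinal hn) hK.
set i := Ordinal hn in xy xmin; have [_ cK _] := hK.
apply/eqyP => A A0.
have mA0 : 0 <= 2 ^+ m * A by rewrite mulr_ge0 ?exprn_ge0 // ltW.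
have [N N1 HN] := poly_near_truncated_cube_not_convex hm mA0.
pose c := N / (y ord0 i - x ord0 i).
have c0 : 0 <= c by rewrite divr_ge0; lra.
pose f := truncated_cube_of_coord m i (x ord0 i) c.
apply: (@le_trans _ _ (convex_approx_error m.-1 K f)); last first.
  apply: ereal_sup_ubound; exists f => //; split.
    exact: truncated_cube_of_coord_convex_continuous.
  exact: modulus_truncated_cube_of_coord_le1.
apply: le_ereal_inf_tmp => _ [p [dp [_ cp]] <-].
rewrite leNgt; apply/negP => pA.
(* Restrict the approximating polynomial to the segment from x to y, on which
   the ridge function becomes 2^-m max(0, N t - 1)^3. *)
have {}dp : (mpoly.msize p <= m)%N by move: dp; rewrite /poly_degree_le /= prednK //; lia.
have [q sq qE] := polyfun_line x (y - x) dp.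
have seg t : 0 <= t <= 1 -> K (x + t *: (y - x)) by exact: convex_set_segment.
have qf t : 0 <= t <= 1 ->
    `|Num.max 0 (N * t - 1) ^+ 3 - (2 ^+ m *: q).[t]| <= 2 ^+ m * A.
  move=> /seg Kt; rewrite hornerZ qE.
  have ft : f (x + t *: (y - x)) = 2 ^- m * Num.max 0 (N * t - 1) ^+ 3.
    rewrite /f /truncated_cube_of_coord !mxE; congr (_ * Num.max 0 (_ - 1) ^+ 3).
    by rewrite /c; field; lra.
  have : `|f (x + t *: (y - x)) - polyfun p (x + t *: (y - x))| <= A.
    rewrite -lee_fin (le_trans _ (ltW pA)) //.
    by apply: ereal_sup_ubound; exists (x + t *: (y - x)).
  rewrite ft -(ler_pM2l (exprn_gt0 m (ltr0Sn R 1))).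
  rewrite -[X in X * `|_|]ger0_norm ?exprn_ge0 // -normrM mulrBr mulrA.
  by rewrite mulfV ?mul1r // expf_neq0 // pnatr_eq0.
have := HN _ (leq_trans (size_scale_leq _ _) sq) qf.
have N0 : 0 <= N^-1 by rewrite invr_ge0; lra.
have N2 : N^-1 <= 1 by rewrite invf_le1; lra.
(* Convexity of p at the parameters 0, 1/(2N), 1/N contradicts the choice of N. *)
have := cp _ _ (seg 0 _) (seg N^-1 _).
have -> : 2^-1 *: (x + 0 *: (y - x) + (x + N^-1 *: (y - x))) =
    x + (N^-1 / 2) *: (y - x).
  by apply/rowP => k; rewrite !mxE; field; lra.
rewrite lexx ler01 N0 N2 -!qE !hornerZ mulrCA -mulrDr => /(_ isT isT) qc.
by rewrite ltr_pM2l ?exprn_gt0 // ltNge qc.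
Qed.
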